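(* In the setting of the context, let the precoders be the maximum ratio transmission (MRT) precoders $\bar{\mathbf w}_{sk}=\bar{\mathbf g}_{sk}$ and $\tilde{\mathbf w}_{sj}=\tilde{\mathbf g}_{sj}$ for all subarrays $s$, near-field users $k\in\mathcal{K_N}$ and far-field users $j\in\mathcal{K_F}$. Then the spectral efficiency $\overline{\mathrm{SE}}_k$ of every near-field user $k\in\mathcal{K_N}$ is $\overline{\mathrm{SE}}_k=\log_2(1+\overline{\mathrm{SINR}}_k)$ with $$\overline{\mathrm{SINR}}_k=\frac{P_n\Big(\sum_{s\in\bar{\mathcal S}_k}\sqrt{\bar\eta_{sk}}\,\bar\Psi_{kk}^s\Big)^2}{\bar\Delta+\sigma_k^2},$$ $$\bar\Delta=P_n\sum_{i\in\mathcal{K_N}\setminus\{k\}}\Big|\sum_{s\in\bar{\mathcal S}_i}\sqrt{\bar\eta_{si}}\,\bar\Psi_{ki}^s\Big|^2+P_f\sum_{j\in\mathcal{K_F}}\sum_{s\in\tilde{\mathcal S}_j}\sum_{s'\in\tilde{\mathcal S}_j}\sqrt{\tilde\eta_{sj}\tilde\eta_{s'j}}\,\tilde\Xi_{kj}^{ss'},$$ where $\bar\Psi_{kk}^s=\bar{\mathbf g}_{sk}^H\bar{\mathbf g}_{sk}$, $\bar\Psi_{ki}^s=\bar{\mathbf g}_{sk}^H\bar{\mathbf g}_{si}$ for $i\neq k$, and $$\tilde\Xi_{kj}^{ss'}=\Re\Big\{\bar{\mathbf g}_{sk}^H\big(\alpha_2^2\bar{\mathbf H}_{2,s}^H\mathbf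 M_{jj}\bar{\mathbf H}_{2,s'}+\delta_{ss'}\varsigma_j\beta_2^2N\,\mathbf I_{M^\ast}\big)\bar{\mathbf g}_{s'k}\Big\},\qquad \mathbf M_{jj}=\boldsymbol\Theta^H\mathbf h_j\mathbf h_j^H\boldsymbol\Theta .$$
   Context: Array and users. A base-station planar array has $M=M_xM_y$ antennas ($M_x,M_y$ odd), spacing $d=\lambda/2$, wavelength $\lambda>0$, partitioned into $S$ subarrays of $M^\ast=M/S$ antennas each; subarray $s\in\mathcal S=\{1,\dots,S\}$ consists of the antennas with indices $r_s=\{(s-1)M^\ast+1,\dots,sM^\ast\}$. Near-field users: $\mathcal{K_N}=\{1,\dots,K_n\}$; far-field users: $\mathcal{K_F}=\{1,\dots,K_f\}$. A reconfigurable intelligent surface (RIS) has $N=N_1N_2$ elements and fixed phase matrix $\boldsymbol\Theta=\mathrm{diag}(e^{j\theta_1},\dots,e^{j\theta_N})$, $\theta_n\in[0,2\pi)$ real. Near-field channels (deterministic, line of sight). Antenna $m$ has coordinates $(m_xd,m_yd,0)$ with $m_x=-\frac{M_x-1}{2}+((m-1)\bmod M_x)$, $m_y=\frac{M_y-1}{2}-\lfloor (m-1)/M_x\rfloor$. User $k\in\mathcal{K_N}$ is at $(u_{k,x},u_{k,y},u_{k,z})$, $u_{k,z}>0$. Put $r_{m,k}=\sqrt{(u_{k,x}-m_xd)^2+(u_{k,y}-m_yd)^2+u_{k,z}^2}$, and $\bar g_{m,k}=\sqrt{\frac{A}{4\pi}\frac{u_{k,z}((u_{k,x}-m_xd)^2+u_{k,z}^2)}{r_{m,k}^5}}\;e^{-j2\pi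 r_{m,k}/\lambda}$ with $A=\lambda^2/(4\pi)$. The channel of subarray $s$ to user $k$ is $\bar{\mathbf g}_{sk}=[\bar g_{m,k}]_{m\in r_s}\in\mathbb C^{M^\ast}$. Far-field channels. The array-to-RIS channel is $\mathbf H_2=\alpha_2\bar{\mathbf H}_2+\beta_2\tilde{\mathbf H}_2\in\mathbb C^{N\times M}$, where $\alpha_2=\sqrt{\iota\zeta/(\iota+1)}$, $\beta_2=\sqrt{\zeta/(\iota+1)}$ with $\iota\geq 0,\zeta>0$; $\bar{\mathbf H}_2=\mathbf b_N(\varphi^a,\varphi^e)\mathbf a_M(\phi^a,\phi^e)^H$ is deterministic, and $\tilde{\mathbf H}_2$ has i.i.d. $\mathcal{CN}(0,1)$ (circularly symmetric) entries. Here, with fixed real angles, $\mathbf a_M(\phi^a,\phi^e)=[e^{j2\pi m d\cos\phi^e\sin\phi^a/\lambda}]_{m=0}^{M_x-1}\otimes[e^{j2\pi m d\sin\phi^e/\lambda}]_{m=0}^{M_y-1}$ and $\mathbf b_N(\varphi^a,\varphi^e)=[e^{j2\pi n d_R\cos\varphi^e\sin\varphi^a/\lambda}]_{n=0}^{N_1-1}\otimes[e^{j2\pi n d_R\sin\varphi^e/\lambda}]_{n=0}^{N_2-1}$ (column vectors), $d_R=\lambda/2$. $\mathbf H_{2,s},\bar{\mathbf H}_{2,s}\in\mathbb C^{N\times M^\ast}$ are the submatrices of $\mathbf H_2,\bar{\mathbf H}_2$ with columns $r_s$. The RIS-to-user channel of $k\in\mathcal{K_F}$ is $\mathbf h_k=\sqrt{\varsigma_k}\,\mathbf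 b_N(\vartheta_k^a,\vartheta_k^e)\in\mathbb C^N$, $\varsigma_k>0$, and the cascaded channel from subarray $s$ is $\tilde{\mathbf g}_{sk}^H=\mathbf h_k^H\boldsymbol\Theta\mathbf H_{2,s}$. Visibility regions and powers. $\bar{\mathcal S}_k\subseteq\mathcal S$ ($k\in\mathcal{K_N}$) and $\tilde{\mathcal S}_j\subseteq\mathcal S$ ($j\in\mathcal{K_F}$) are given sets of subarrays serving each user (visibility regions). $P_n,P_f>0$ are powers, $\bar\eta_{sk},\tilde\eta_{sj}\ge0$ are power-control coefficients, $\sigma_k^2>0$ is the noise power. Spectral efficiency of near-field user $k$ for given precoders $\bar{\mathbf w}_{sk},\tilde{\mathbf w}_{sj}\in\mathbb C^{M^\ast}$: by definition $\overline{\mathrm{SE}}_k=\log_2(1+\overline{\mathrm{SINR}}_k)$, where $$\overline{\mathrm{SINR}}_k=\frac{|\overline{\mathrm{DS}}_k|^2}{\sum_{i\in\mathcal{K_N}\setminus\{k\}}|\overline{\mathrm{UI}}^{\mathrm N}_i|^2+\sum_{j\in\mathcal{K_F}}\mathbb E\{|\overline{\mathrm{UI}}^{\mathrm F}_j|^2\}+\sigma_k^2},$$ $\overline{\mathrm{DS}}_k=\sqrt{P_n}\sum_{s\in\bar{\mathcal S}_k}\sqrt{\bar\eta_{sk}}\bar{\mathbf g}_{sk}^H\bar{\mathbf w}_{sk}$, $\overline{\mathrm{UI}}^{\mathrm N}_i=\sqrt{P_n}\sum_{s\in\bar{\mathcal S}_i}\sqrt{\bar\eta_{si}}\bar{\mathbf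 g}_{sk}^H\bar{\mathbf w}_{si}$, $\overline{\mathrm{UI}}^{\mathrm F}_j=\sqrt{P_f}\sum_{s\in\tilde{\mathcal S}_j}\sqrt{\tilde\eta_{sj}}\bar{\mathbf g}_{sk}^H\tilde{\mathbf w}_{sj}$. Expectations are over $\tilde{\mathbf H}_2$; $\delta_{ss'}$ is the Kronecker delta. *)

(* Defs.v *)
From HB Require Import structures.
From mathcomp Require Import all_boot all_order all_algebra spectral.
From mathcomp Require Import mxtens complex.
From mathcomp Require Import all_classical all_reals all_analysis.

Set Implicit Arguments.
Unset Strict Implicit.
Unset Printing Implicit Defensive.

Import Order.TTheory GRing.Theory Num.Theory.
Import numFieldNormedType.Exports.

Local Open Scope classical_set_scope.
Local Open Scope complex_scope.
Local Open Scope sesquilinear_scope.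
Local Open Scope ring_scope.

Section scalars.
Context {R : realType}.
Implicit Types (x : R) (z : R[i]).

Definition log2 x : R := ln x / ln 2.

(* e^{jx} *)
Definition cis x : R[i] := cos x +i* sin x.

(* In R[i] the norm `|z| is R[i]-valued (with zero imaginary part). *)
Definition cabs z : R := complex.Re `|z|.

(* The inner product u^H v, conjugate-linear in [u]. *)
Definition hdot n (u v : 'cV[R[i]]_n) : R[i] := (u^t* *m v) 0 0.

End scalars.

Section randomness.
Context {R : realType} d (T : measurableType d) (P : probability T R).

Definition mutually_independent d' (T' : measurableType d') (I : finType)
    (X : I -> T -> T') : Prop :=
  forall (J : {set I}) (A : I -> set T'),
    (forall i, i \in J -> measurable (A i)) ->
    P (\bigcap_(i in [set i | i \in J]) (X i @^-1` A i)) =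
    (\prod_(i in J) P (X i @^-1` A i))%E.

(* R[i] carries no measurable structure in the library: a complex random
   variable is handled through the R * R-valued map of its real and imaginary
   parts. *)
Definition complex_pair (X : T -> R[i]) (w : T) : R * R :=
  (complex.Re (X w), complex.Im (X w)).

(* The circularly symmetric law CN(0,1): independent real and imaginary parts,
   each N(0, 1/2); the second argument of normal_prob is the standard
   deviation. *)
Definition CN01 : set (R * R) -> \bar R :=
  (normal_prob 0 (Num.sqrt 2^-1 : R) \x normal_prob 0 (Num.sqrt 2^-1 : R))%E.

Definition iid_CN01 (I : finType) (X : I -> T -> R[i]) : Prop :=
  [/\ forall i, measurable_fun setT (complex_pair (X i)),
      forall i (A : set (R * R)), measurable A ->
        P (complex_pair (X i) @^-1` A) = CN01 A &
      mutually_independent (fun i => complex_pair (X i))].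

End randomness.

Section array.
Context {R : realType}.
Variables (Mx My : nat) (lambda : R).

(* Antenna indices are 0-based: [m] stands for the 1-based index m+1. *)
Definition antenna_x (m : nat) : R := - ((Mx%:R - 1) / 2) + (m %% Mx)%N%:R.
Definition antenna_y (m : nat) : R := (My%:R - 1) / 2 - (m %/ Mx)%N%:R.

Definition nf_dist (ux uy uz : R) (m : nat) : R :=
  let d := lambda / 2 in
  Num.sqrt ((ux - antenna_x m * d) ^+ 2 + (uy - antenna_y m * d) ^+ 2
            + uz ^+ 2).

Definition nf_coef (ux uy uz : R) (m : nat) : R[i] :=
  let d := lambda / 2 in
  let A := lambda ^+ 2 / (4 * pi) in
  let r := nf_dist ux uy uz m in
  (Num.sqrt (A / (4 * pi)
     * (uz * ((ux - antenna_x m * d) ^+ 2 + uz ^+ 2) / r ^+ 5)))%:C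
  * cis (- (2 * pi * r / lambda)).

(* Subarray [s] consists of the 0-based antenna indices s * Ms + l, l < Ms. *)
Definition subarray_idx (S Ms : nat) (hM : (S * Ms = Mx * My)%N)
    (s : 'I_S) (l : 'I_Ms) : 'I_(Mx * My) :=
  cast_ord hM (mxtens_index (s, l)).

Definition nf_channel (S Ms : nat) (hM : (S * Ms = Mx * My)%N)
    (ux uy uz : R) (s : 'I_S) : 'cV[R[i]]_Ms :=
  \col_l nf_coef ux uy uz (subarray_idx hM s l).

End array.

Section far_field.
Context {R : realType}.

(* Steering vector of a p x q planar array with element spacing [dd];
   [tensmx] is the Kronecker product. *)
Definition steering (p q : nat) (lambda dd az el : R) : 'cV[R[i]]_(p * q) :=
  tensmx (\col_(m < p) cis (2 * pi * m%:R * dd * cos el * sin az / lambda))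
         (\col_(m < q) cis (2 * pi * m%:R * dd * sin el / lambda)).

Definition phase_mx N (theta : 'I_N -> R) : 'M[R[i]]_N :=
  diag_mx (\row_n cis (theta n)).

Definition ris_user N (varsigma : R) (b : 'cV[R[i]]_N) : 'cV[R[i]]_N :=
  (Num.sqrt varsigma)%:C *: b.

(* The cascaded channel g is defined through g^H = h^H Theta H_{2,s}. *)
Definition cascaded N Ms (h : 'cV[R[i]]_N) (Theta : 'M[R[i]]_N)
    (H2s : 'M[R[i]]_(N, Ms)) : 'cV[R[i]]_Ms :=
  (h^t* *m Theta *m H2s)^t*.

End far_field.

Section spectral_efficiency.
Context {R : realType} d (T : measurableType d) (P : probability T R).
Variables (S Ms Kn Kf : nat).
Variables (Sn : 'I_Kn -> {set 'I_S}) (Sf : 'I_Kf -> {set 'I_S}).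
Variables (Pn Pf : R) (etan : 'I_S -> 'I_Kn -> R) (etaf : 'I_S -> 'I_Kf -> R).
Variables (sigma : 'I_Kn -> R).
Variables (g wn : 'I_S -> 'I_Kn -> 'cV[R[i]]_Ms).
(* The far-field precoders may depend on the random channel. *)
Variable wf : 'I_S -> 'I_Kf -> T -> 'cV[R[i]]_Ms.

Definition DS_near (k : 'I_Kn) : R[i] :=
  (Num.sqrt Pn)%:C *
  \sum_(s in Sn k) (Num.sqrt (etan s k))%:C * hdot (g s k) (wn s k).

(* Interference received by user k from the beam of user i. *)
Definition UI_near (k i : 'I_Kn) : R[i] :=
  (Num.sqrt Pn)%:C *
  \sum_(s in Sn i) (Num.sqrt (etan s i))%:C * hdot (g s k) (wn s i).

Definition UI_far (k : 'I_Kn) (j : 'I_Kf) (w : T) : R[i] :=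
  (Num.sqrt Pf)%:C *
  \sum_(s in Sf j) (Num.sqrt (etaf s j))%:C * hdot (g s k) (wf s j w).

(* The SINR and the SE are extended-real valued since the expectation is; this
   avoids a junk value in case of an infinite expectation. *)
Definition SINR_near (k : 'I_Kn) : \bar R :=
  ((cabs (DS_near k) ^+ 2)%:E /
   (\sum_(i < Kn | i != k) (cabs (UI_near k i) ^+ 2)%:E
    + \sum_(j < Kf) 'E_P[(fun w => cabs (UI_far k j w) ^+ 2)%R]
    + (sigma k ^+ 2)%:E))%E.

Definition SE_near (k : 'I_Kn) : \bar R :=
  (lne (1 + SINR_near k) / (ln 2)%:E)%E.

End spectral_efficiency.

(* Main.v *)
(** The precoder of a far-field user is its own cascaded channel, so what
    near-field user k receives from it is the conjugate of z + sum_i c_i X_i,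
    where the X_i are the entries of the scattered part of the array-to-RIS
    channel. These are uncorrelated, centred and of unit variance, hence
    E |z + sum_i c_i X_i|^2 = |z|^2 + sum_i |c_i|^2. The alpha_2^2 part of the
    double sum over subarrays is |z|^2. Since distinct subarrays use distinct
    entries, sum_i |c_i|^2 only contributes for s = s'; its factor varsigma_j N
    is the squared norm of h_j^H Theta, whose N entries all have modulus
    sqrt varsigma_j. *)
Require Import Defs.
From HB Require Import structures.
From mathcomp Require Import all_boot all_order all_algebra spectral.
From mathcomp Require Import mxtens complex.
From mathcomp Require Import all_classical all_reals all_analysis.
From mathcomp Require Import measurable_realfun ring lra.

Set Implicit Arguments.
Unset Strict Implicit.
Unset Printing Implicit Defensive.

Import Order.TTheory GRing.Theory Num.Theory.
Import numFieldNormedType.Exports.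

Local Open Scope classical_set_scope.
Local Open Scope complex_scope.
Local Open Scope sesquilinear_scope.
Local Open Scope ring_scope.

(** * Moments of the normal law of variance 1/2 *)

Section gauss_moments.
Context {R : realType}.
Let mu := @lebesgue_measure R.

(** Squeezed between 0 and [1/x], because [x^2 <= 1 + x^2 <= exp(x^2)]. *)
Lemma cvg_mulr_gauss_fun : x * gauss_fun x @[x --> +oo] --> (0 : R).
Proof.
apply: (@squeeze_cvgr _ _ _ _ (cst 0) (fun x : R => x^-1)).
- near=> x => /=.
  have x0 : 0 < x by near: x; exact: nbhs_pinfty_gt.
  rewrite mulr_ge0 ?gauss_fun_ge0 ?(ltW x0)//=.
  rewrite -(ler_pM2l x0) mulfV ?gt_eqF// mulrA -expr2 /gauss_fun expRN.
  rewrite ler_pdivrMr ?expR_gt0// mul1r.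
  by apply: le_trans (expR_ge1Dx _); rewrite lerDr ler01.
- exact: cvg_cst.
- apply: (iffRL (@gtr0_cvgV0 _ _ _ _ id _)); last exact: cvg_id.
  exact: nbhs_pinfty_gt.
Unshelve. all: by end_near. Qed.

(** Integration by parts: [x * gauss_fun x] has derivative [gauss_fun x - 2 x^2 gauss_fun x] and
    vanishes at 0 and at infinity, so what remains is the Gaussian integral over the half-line. *)
Lemma integral0y_sqr_gauss :
  (\int[mu]_(x in `[0%R, +oo[) (2 * x ^+ 2 * gauss_fun x)%:E =
   (Num.sqrt pi / 2)%:E)%E.
Proof.
pose G := @gauss_integral_proof.integral0_gauss R.
(* The known limit, [pi / 4], is that of [G^2]; since [G >= 0], taking square roots gives the limit
   of [G]. *)
have cG : G x @[x --> +oo] --> Num.sqrt pi / 2.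
  have : Num.sqrt (G x ^+ 2) @[x --> +oo] --> Num.sqrt (pi / 4).
    apply: continuous_cvg; first exact: sqrt_continuous.
    exact: gauss_integral_proof.cvg_integral0_gauss_sqr.
  have -> : Num.sqrt (pi / 4) = Num.sqrt pi / 2 :> R.
    rewrite sqrtrM ?pi_ge0// sqrtrV// (_ : 4 = 2 ^+ 2); last by ring.
    by rewrite sqrtr_sqr ger0_norm.
  rewrite (_ : (fun _ => Num.sqrt _) = G)//.
  apply/funext => x; rewrite sqrtr_sqr ger0_norm//.
  exact: gauss_integral_proof.integral0_gauss_ge0.
have ig (u : R) : mu.-integrable `[0, u] (EFin \o gauss_fun).
  apply: (integrableS measurableT) => //; exact: integrableT_gauss.
(* The right endpoint [x + 1] only serves to make [x] an interior point of the interval of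
   integration. *)
have dG (x : R) : 0 < x -> derivable G x 1 /\ G^`()%classic x = gauss_fun x.
  move=> x0; have xx1 : x < x + 1 by rewrite ltrDl.
  exact: (continuous_FTC1_closed xx1 (ig _) x0 (@continuous_gauss_fun R x)).
have dg (x : R) : is_derive x 1 (fun y : R => y * gauss_fun y)
    (gauss_fun x - 2 * x ^+ 2 * gauss_fun x).
  have d2 : is_derive x (1 : R) (fun y : R => - y ^+ 2 : R) (- (2 * x)).
    have := is_deriveN (@is_deriveX _ _ id 2 x 1 1 (is_derive_id _ _)).
    rewrite /GRing.scale /= expr1 mulr1; exact.
  have := is_derive1_comp (is_derive_expR _) d2 => d1.
  have d3 := is_deriveM (is_derive_id x (1 : R)) d1.
  apply: (@is_derive_eq _ _ _ _ _ _ _ _ d3).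
  by rewrite /GRing.scale /= /gauss_fun; ring.
(* antiderivative of [2 x^2 e^(-x^2)] *)
pose F x := G x - x * gauss_fun x.
have G0 : G 0 = 0.
  by rewrite /G /gauss_integral_proof.integral0_gauss set_itv1 Rintegral_set1.
have F0 : F 0 = 0 by rewrite /F mul0r subr0.
rewrite (@ge0_continuous_FTC2y _ _ F _ (Num.sqrt pi / 2)).
- by rewrite F0 oppe0 adde0.
- move=> x x0; rewrite !mulr_ge0 ?gauss_fun_ge0 ?sqr_ge0//.
- apply: continuous_subspaceT => x.
  apply: cvgM; last exact: continuous_gauss_fun.
  apply: cvgM; first exact: cvg_cst.
  exact: exprn_continuous.
- rewrite -[X in _ --> X]subr0; apply: cvgB => //; exact: cvg_mulr_gauss_fun.
- move=> x x0; apply: derivableB; first by have [] := dG _ x0.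
  exact: ex_derive.
- apply: cvgB.
    apply: cvg_at_right_filter; rewrite G0.
    exact: (parameterized_integral_cvg_left ltr01 (ig 1)).
  apply: cvg_at_right_filter; apply: cvgM; first exact: cvg_id.
  exact: continuous_gauss_fun.
- move=> x; rewrite in_itv /= andbT => x0.
  rewrite derive1E deriveB; [|by have [] := dG _ x0|exact: ex_derive].
  rewrite -derive1E (dG _ x0).2 derive_val; ring.
Qed.

Lemma integralT_sqr_gauss :
  (\int[mu]_x (x ^+ 2 * gauss_fun x)%:E = (Num.sqrt pi / 2)%:E)%E.
Proof.
have f0 (x : R) : 0 <= x ^+ 2 * gauss_fun x.
  by rewrite mulr_ge0 ?sqr_ge0 ?gauss_fun_ge0.
have cf : continuous (fun x : R => x ^+ 2 * gauss_fun x).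
  move=> x; apply: cvgM; last exact: continuous_gauss_fun.
  exact: exprn_continuous.
rewrite ge0_symfun_integralT//; last by move=> x /=; rewrite /gauss_fun sqrrN.
rewrite -ge0_integralZl_EFin//.
- rewrite -set_itvcy -integral0y_sqr_gauss; apply: eq_integral => x _.
  by rewrite -EFinM mulrA.
- by rewrite -set_itvcy.
- by move=> x _; rewrite lee_fin.
- apply/measurable_EFinP/measurable_funTS; exact: continuous_measurable_fun.
Qed.

(** Cutting the line at 0 and substituting on the negative half writes the integral as two integrals
    over the positive half-line, which the reflection swaps. For [f >= 0] this holds in the extended
    reals, before finiteness is known. *)
Lemma ge0_integralT_oppr (f : R -> R) :
  (forall x, 0 <= f x) -> continuous f ->
  (\int[mu]_x (f (- x))%:E = \int[mu]_x (f x)%:E)%E.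
Proof.
pose half (h : R -> R) := (\int[mu]_(x in `[0%R, +oo[) (h x)%:E)%E.
have split_half (h : R -> R) : (forall x, 0 <= h x) -> continuous h ->
    (\int[mu]_x (h x)%:E = half h + half (h \o -%R))%E.
  move=> h0 ch; have mh : measurable_fun [set: R] h.
    exact: continuous_measurable_fun.
  rewrite /half -(setUv (`[0%R, +oo[ : set R)).
  rewrite ge0_integral_setU//=; last 4 first.
    exact: measurableC.
    by apply/measurable_EFinP; rewrite setUv.
    by move=> x _; rewrite lee_fin.
    exact/disj_setPCl.
  congr +%E; rewrite setCitvr integral_itv_bndo_bndc; last first.
    exact/measurable_EFinP/measurable_funTS.
  rewrite -{1}oppr0 ge0_integration_by_substitutionNy//.
  exact: continuous_subspaceT.
move=> f0 cf; rewrite split_half// ?(split_half f)//; last first.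
  by move=> x; apply: continuous_comp; [exact: oppr_continuous|exact: cf].
by rewrite addeC; congr (half _ + _)%E; apply/funext => x /=; rewrite opprK.
Qed.

(** The Radon-Nikodym derivative of the normal law equals the explicit density almost everywhere,
    since both have the same integral over every measurable set. *)
Lemma ge0_integral_normal_prob (m s : R) (f : R -> \bar R) :
  (forall x, 0 <= f x)%E -> measurable_fun setT f ->
  (\int[normal_prob m s]_x f x = \int[mu]_x (f x * (normal_pdf m s x)%:E))%E.
Proof.
move=> f0 mf; have nu_mu := normal_prob_dominates m s.
have mpdf : measurable_fun setT (fun x : R => (normal_pdf m s x)%:E).
  apply/measurable_EFinP; exact: measurable_normal_pdf.
have iRN := Radon_Nikodym_SigmaFinite.f_integrable nu_mu.
rewrite -(Radon_Nikodym_SigmaFinite.change_of_variables nu_mu)//.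
apply: ae_eq_integral => //.
- by apply: emeasurable_funM => //; exact: measurable_int iRN.
- exact: emeasurable_funM.
- apply: ae_eqe_mul2l; apply: integral_ae_eq => // A _ mA.
  by rewrite -Radon_Nikodym_SigmaFinite.f_integral.
Qed.

(* the standard deviation of the two coordinates of CN(0,1) *)
Let s12 : R := Num.sqrt 2^-1.

(** For variance 1/2 the exponent [x^2 / (2 s^2)] is exactly [x^2], so the integrals above apply
    without rescaling. *)
Lemma normal_pdf_sqrt_half (x : R) :
  normal_pdf 0 s12 x = (Num.sqrt pi)^-1 * gauss_fun x.
Proof.
have s0 : s12 != 0 by rewrite gt_eqF// sqrtr_gt0.
have s2 : s12 ^+ 2 *+ 2 = 1 by rewrite sqr_sqrtr// -mulr_natr mulVf.
rewrite normal_pdfE// /normal_peak /normal_fun subr0 s2 divr1.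
by rewrite -mulrnAl s2 mul1r.
Qed.

Lemma normal_prob_second_moment :
  (\int[normal_prob 0 s12]_x (x ^+ 2)%:E = (2^-1)%:E)%E.
Proof.
rewrite ge0_integral_normal_prob; last 2 first.
- by move=> x; rewrite lee_fin sqr_ge0.
- exact/measurable_EFinP/measurable_funX.
under eq_integral do rewrite -EFinM normal_pdf_sqrt_half mulrCA EFinM.
rewrite ge0_integralZl_EFin//.
- rewrite integralT_sqr_gauss -EFinM mulrA mulVf ?mul1r//.
  by rewrite gt_eqF// sqrtr_gt0 pi_gt0.
- by move=> x _; rewrite lee_fin mulr_ge0 ?sqr_ge0 ?gauss_fun_ge0.
- apply/measurable_EFinP/measurable_funM; first exact: measurable_funX.
  exact: measurable_gauss_fun.
Qed.

(** The integrals of the positive and negative parts are mirror images of each other, so they cancel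
    once they are known to be finite. *)
Lemma normal_prob_first_moment :
  (\int[normal_prob 0 s12]_x x%:E = 0)%E.
Proof.
pose f (x : R) := Num.max x 0 * ((Num.sqrt pi)^-1 * gauss_fun x).
have f0 x : 0 <= f x.
  by rewrite !mulr_ge0 ?invr_ge0 ?gauss_fun_ge0// le_max lexx orbT.
have cf : continuous f.
  move=> x; apply: cvgM; last first.
    by apply: cvgM; [exact: cvg_cst|exact: continuous_gauss_fun].
  by apply: (@continuous_max R R id (cst 0)); [exact: cvg_id|exact: cvg_cst].
rewrite integralE !ge0_integral_normal_prob//=; last 2 first.
- exact: measurable_funeneg.
- exact: measurable_funepos.
have -> : (\int[mu]_x ((EFin^\- x) * (normal_pdf 0 s12 x)%:E) =
  \int[mu]_x (f (- x))%:E)%E.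
  apply: eq_integral => x _.
  rewrite funenegE normal_pdf_sqrt_half -EFinN -EFin_max -EFinM.
  by rewrite /f /gauss_fun sqrrN.
have -> : (\int[mu]_x ((EFin^\+ x) * (normal_pdf 0 s12 x)%:E) =
  \int[mu]_x (f x)%:E)%E.
  by apply: eq_integral => x _; rewrite funeposE normal_pdf_sqrt_half -EFin_max.
rewrite ge0_integralT_oppr// subee//.
have mf : measurable_fun setT f by exact: continuous_measurable_fun.
rewrite ge0_fin_numE; last by apply: integral_ge0 => x _; rewrite lee_fin.
have i2 := normal_prob_second_moment.
rewrite ge0_integral_normal_prob in i2; last 2 first.
- by move=> x; rewrite lee_fin sqr_ge0.
- exact/measurable_EFinP/measurable_funX.
have mpdf : measurable_fun setT (fun x : R => (normal_pdf 0 s12 x)%:E).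
  apply/measurable_EFinP; exact: measurable_normal_pdf.
(* Finiteness: [max x 0 <= x^2 + 1] bounds the integral by the second moment plus the total mass. *)
apply: (@le_lt_trans _ _
    (\int[mu]_x (((x ^+ 2)%:E + 1) * (normal_pdf 0 s12 x)%:E))%E).
  apply: ge0_le_integral => //.
  - by move=> x _; rewrite lee_fin.
  - exact/measurable_EFinP.
  - apply: emeasurable_funM => //; apply: emeasurable_funD => //.
    exact/measurable_EFinP/measurable_funX.
  move=> x _; rewrite -EFinD -EFinM lee_fin normal_pdf_sqrt_half.
  rewrite ler_wpM2r// ?mulr_ge0 ?invr_ge0 ?gauss_fun_ge0// ge_max.
  rewrite addr_ge0 ?sqr_ge0// andbT; have := sqr_ge0 (x - 1); nra.
under eq_integral do rewrite ge0_muleDl ?lee_fin ?sqr_ge0// mul1e.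
rewrite ge0_integralD//.
- by rewrite i2 integral_normal_pdf ltry.
- by move=> x _; rewrite mule_ge0 ?lee_fin ?sqr_ge0 ?normal_pdf_ge0.
- apply: emeasurable_funM => //; exact/measurable_EFinP/measurable_funX.
- by move=> x _; rewrite lee_fin normal_pdf_ge0.
Qed.
End gauss_moments.
(** * Second moments of independent variables *)

Section expectation_value.
Context {R : realType} d (T : measurableType d) (P : probability T R).
Implicit Types (X Y : T -> R) (x y : R).

(** Integrability is bundled with the value, so that the linearity rules chain without side
    conditions. *)
Definition has_expectation X x : Prop :=
  P.-integrable setT (EFin \o X) /\ (\int[P]_w (X w)%:E = x%:E)%E.

Lemma has_expectation_cst x : has_expectation (cst x) x.
Proof.
split; first exact: finite_measure_integrable_cst.
by have := expectation_cst P x; rewrite unlock.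
Qed.

Lemma has_expectationD X x Y y : has_expectation X x -> has_expectation Y y ->
  has_expectation (fun w => X w + Y w) (x + y).
Proof.
move=> [iX EX] [iY EY]; split.
  by rewrite (_ : _ \o _ = (EFin \o X) \+ (EFin \o Y))%E//; exact: integrableD.
rewrite -[LHS]/(\int[P]_w ((EFin \o X) w + (EFin \o Y) w))%E.
by rewrite integralD// EX EY.
Qed.

Lemma has_expectationZ c X x : has_expectation X x ->
  has_expectation (fun w => c * X w) (c * x).
Proof.
move=> [iX EX]; split; first exact: (integrableZl _ c iX).
by under eq_integral do rewrite EFinM; rewrite integralZl// EX.
Qed.

Lemma has_expectation_sum (I : finType) (X : I -> T -> R) (x : I -> R) :
  (forall i, has_expectation (X i) (x i)) ->
  has_expectation (fun w => \sum_i X i w) (\sum_i x i).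
Proof.
move=> EX; elim: (index_enum I) => [|i s IHs].
  rewrite big_nil (_ : (fun _ => _) = cst 0); first exact: has_expectation_cst.
  by apply/funext => w; rewrite big_nil.
rewrite big_cons (_ : (fun _ => _) = fun w => X i w + \sum_(j <- s) X j w).
  exact: has_expectationD.
by apply/funext => w; rewrite big_cons.
Qed.

End expectation_value.

Section independence.
Context {R : realType} d (T : measurableType d) (P : probability T R).
Implicit Types (X Y : T -> R).

(** Independence says that the joint law agrees with the product of the marginal laws on rectangles,
    hence everywhere; Fubini then factors the integral of the product. *)
Lemma has_expectationM_indep X Y x y :
  P.-integrable setT (fun w => (X w ^+ 2)%:E) ->
  P.-integrable setT (fun w => (Y w ^+ 2)%:E) ->
  (forall A B, measurable A -> measurable B ->
    P (X @^-1` A `&` Y @^-1` B) = (P (X @^-1` A) * P (Y @^-1` B))%E) ->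
  has_expectation P X x -> has_expectation P Y y ->
  has_expectation P (fun w => X w * Y w) (x * y).
Proof.
move=> iX2 iY2 XY [iX EX] [iY EY].
have mX : measurable_fun setT X.
  by apply/measurable_EFinP; exact: measurable_int iX.
have mY : measurable_fun setT Y.
  by apply/measurable_EFinP; exact: measurable_int iY.
(* Dominated by [X^2 + Y^2]. *)
have iXY : P.-integrable setT (fun w => (X w * Y w)%:E).
  apply: le_integrable (integrableD _ iX2 iY2) => //.
    by apply/measurable_EFinP; exact: measurable_funM.
  move=> w _ /=; rewrite lee_fin [leRHS]ger0_norm ?addr_ge0 ?sqr_ge0//.
  rewrite normrM -(real_normK (num_real (X w))) -(real_normK (num_real (Y w))).
  have := sqr_ge0 (`|X w| - `|Y w|).
  have := normr_ge0 (X w); have := normr_ge0 (Y w); nra.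
split => //.
pose Xp : {mfun T >-> R} := HB.pack X (isMeasurableFun.Build _ _ _ _ _ mX).
pose Yp : {mfun T >-> R} := HB.pack Y (isMeasurableFun.Build _ _ _ _ _ mY).
pose Z w := (X w, Y w).
have mZ : measurable_fun setT Z by exact/measurable_fun_pairP.
pose Zp : {mfun T >-> (R * R)%type} :=
  HB.pack Z (isMeasurableFun.Build _ _ _ _ _ mZ).
pose PX := distribution P Xp.
pose PY := distribution P Yp.
pose PZ := distribution P Zp.
have PZE C : measurable C -> (PX \x PY)%E C = PZ C.
  apply: product_measure_unique => A B mA mB; exact: XY.
pose f (z : R * R) := (z.1 * z.2)%:E.
have mf : measurable_fun setT f.
  by apply/measurable_EFinP; exact: measurable_funM.
(* Fubini requires integrability under the product law; it is transported from [iXY] through the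
   joint law [PZ]. *)
have if_ : (PX \x PY)%E.-integrable setT f.
  apply/integrableP; split => //.
  rewrite (eq_measure_integral PZ); last by move=> A mA _; exact: PZE.
  rewrite ge0_integral_distribution//; first by case/integrableP : iXY.
  exact: measurableT_comp.
transitivity (\int[PZ]_z f z)%E; first by rewrite integral_distribution.
rewrite -(eq_measure_integral PZ (m1 := (PX \x PY)%E)); last first.
  by move=> A mA _; exact: PZE.
rewrite -integral12_prod_meas1//.
have EPX : (\int[PX]_a a%:E = x%:E)%E.
  by rewrite -EX integral_distribution//; exact/measurable_EFinP.
have EPY : (\int[PY]_b b%:E = y%:E)%E.
  by rewrite -EY integral_distribution//; exact/measurable_EFinP.
have iPX : PX.-integrable setT (fun a : R => a%:E).
  apply: (@integrable_pushforward _ _ _ _ _ X mX) => //.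
  exact/measurable_EFinP.
have iPY : PY.-integrable setT (fun b : R => b%:E).
  apply: (@integrable_pushforward _ _ _ _ _ Y mY) => //.
  exact/measurable_EFinP.
transitivity (\int[PX]_a (a%:E * y%:E))%E.
  apply: eq_integral => a _; rewrite /fubini_F.
  by under eq_integral do rewrite /f/= EFinM; rewrite integralZl// EPY.
by rewrite integralZr// EPX EFinM.
Qed.
End independence.
Section second_moment.
Context {R : realType} d (T : measurableType d) (P : probability T R).

(** When the square is expanded, the linear terms vanish by centring and the off-diagonal products
    by uncorrelatedness. *)
Lemma has_expectation_sqr_affine (K : finType) (W : K -> T -> R) (v x : R)
    (a : K -> R) :
  (forall k, has_expectation P (W k) 0) ->
  (forall k l, has_expectation P (fun w => W k w * W l w) (v *+ (k == l))) ->
  has_expectation P (fun w => (x + \sum_k a k * W k w) ^+ 2)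
    (x ^+ 2 + v * \sum_k a k ^+ 2).
Proof.
move=> EW EWW.
have -> : (fun w => (x + \sum_k a k * W k w) ^+ 2) = (fun w => x ^+ 2 +
    (\sum_k (2 * x * a k) * W k w +
     \sum_k \sum_l (a k * a l) * (W k w * W l w))).
  apply/funext => w; rewrite sqrrD -addrA; congr (_ + (_ + _)).
    by rewrite -mulr_natl mulrA mulr_sumr; apply: eq_bigr => k _; rewrite mulrA.
  rewrite expr2 mulr_suml; apply: eq_bigr => k _.
  by rewrite mulr_sumr; apply: eq_bigr => l _; rewrite mulrACA.
(* The value takes the unevaluated shape of the expansion, so that linearity applies term by
   term. *)
have -> : x ^+ 2 + v * \sum_k a k ^+ 2 = x ^+ 2 +
    (\sum_k (2 * x * a k) * 0 + \sum_k \sum_l (a k * a l) * (v *+ (k == l))).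
  congr (_ + _); rewrite [X in _ = X + _]big1 ?add0r; last first.
    by move=> k _; rewrite mulr0.
  rewrite mulr_sumr; apply: eq_bigr => k _.
  rewrite (bigD1 k)//= eqxx big1 ?addr0 1?mulrC ?expr2// => l lk.
  by rewrite eq_sym (negbTE lk) mulr0.
apply: has_expectationD; first exact: has_expectation_cst.
apply: has_expectationD; apply: has_expectation_sum => k.
  exact: has_expectationZ.
by apply: has_expectation_sum => l; exact: has_expectationZ.
Qed.

End second_moment.

(** * Affine combinations of circularly symmetric Gaussians *)

Section complex_parts.
Context {R : realType}.
Implicit Types (z : R[i]).

Lemma ReD : {morph @complex.Re R : z w / z + w}. Proof. by move=> [? ?] []. Qed.

Lemma ImD : {morph @complex.Im R : z w / z + w}. Proof. by move=> [? ?] []. Qed.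

Lemma Re_sum (I : finType) (Q : pred I) (F : I -> R[i]) :
  complex.Re (\sum_(i | Q i) F i) = \sum_(i | Q i) complex.Re (F i).
Proof. exact: (big_morph _ ReD). Qed.

Lemma Im_sum (I : finType) (Q : pred I) (F : I -> R[i]) :
  complex.Im (\sum_(i | Q i) F i) = \sum_(i | Q i) complex.Im (F i).
Proof. exact: (big_morph _ ImD). Qed.

Lemma cabs_sqr z : cabs z ^+ 2 = complex.Re z ^+ 2 + complex.Im z ^+ 2.
Proof. by rewrite /cabs normc_def /= sqr_sqrtr// addr_ge0 ?sqr_ge0. Qed.

End complex_parts.

Section complex_gaussian.
Context {R : realType} d (T : measurableType d) (P : probability T R).
Variables (I : finType) (X : I -> T -> R[i]).
Hypothesis iidX : iid_CN01 P X.

Let s12 : R := Num.sqrt 2^-1.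
Let nu := normal_prob 0 s12.

Let coord (b : bool) (z : R * R) : R := if b then z.1 else z.2.
(** All real and imaginary parts form a single real family over [I * bool], to which the real
    second-moment formula applies. *)
Let W (k : I * bool) (w : T) : R := coord k.2 (complex_pair (X k.1) w).
Let cyl (b : bool) (A : set R) : set (R * R) :=
  if b then A `*` setT else setT `*` A.

Let WE i b A : W (i, b) @^-1` A = complex_pair (X i) @^-1` cyl b A.
Proof. by rewrite /W /cyl; case: b; apply/seteqP; split => w //= []. Qed.

Let measurable_cyl b A : measurable A -> measurable (cyl b A).
Proof. by move=> mA; case: b; exact: measurableX. Qed.

Let CN01X A B : measurable A -> measurable B ->
  CN01 (A `*` B) = (nu A * nu B)%E.
Proof. by move=> mA mB; rewrite /CN01 product_measure1E. Qed.

Let CN01_cyl b A : measurable A -> CN01 (cyl b A) = nu A.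
Proof.
have nuT : nu setT = 1%E by exact: probability_setT.
by move=> mA; case: b; rewrite /cyl CN01X// nuT ?mule1 ?mul1e.
Qed.

Let measurable_W k : measurable_fun setT (W k).
Proof.
case: iidX => mX _ _; case: k => i b; rewrite /W /coord.
by case: b; apply: measurableT_comp (mX i).
Qed.

Let law_W k A : measurable A -> P (W k @^-1` A) = nu A.
Proof.
case: k => i b mA; case: iidX => _ lawX _.
by rewrite WE lawX ?CN01_cyl//; exact: measurable_cyl.
Qed.

(** For different entries this is mutual independence restricted to a pair of indices; for the two
    parts of one entry it is the product form of [CN01]. *)
Let indep_W k l A B : k != l -> measurable A -> measurable B ->
  P (W k @^-1` A `&` W l @^-1` B) = (P (W k @^-1` A) * P (W l @^-1` B))%E.
Proof.
case: iidX => _ lawX indX; case: k l => [i b] [j c] kl mA mB.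
have [ij|ij] := eqVneq i j; last first.
  pose F m := if m == i then cyl b A else cyl c B.
  have := indX [set i; j]%SET F.
  rewrite big_setU1 ?inE//= big_set1 /F eqxx.
  rewrite (negbTE (_ : j != i)); last by rewrite eq_sym.
  rewrite !WE => <-; last by move=> m _; case: ifP => _; exact: measurable_cyl.
  congr (P _); apply/seteqP; split => w /=.
    move=> [wA wB] m /=; rewrite !inE => /orP[] /eqP ->; first by rewrite eqxx.
    by rewrite (negbTE (_ : j != i))// eq_sym.
  move=> h; split; first by have := h i; rewrite /= !inE eqxx; exact.
  have := h j; rewrite /= !inE eqxx orbT (negbTE (_ : j != i)); first exact.
  by rewrite eq_sym.
rewrite {}ij {i} in kl *; rewrite !law_W//.
case: b c kl => -[]; rewrite ?eqxx// => _; last rewrite setIC muleC.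
  by rewrite -CN01X// -(lawX j)//; exact: measurableX.
by rewrite -CN01X// -(lawX j)//; exact: measurableX.
Qed.

Let integral_W_sqr k : (\int[P]_w (W k w ^+ 2)%:E = (2^-1)%:E)%E.
Proof.
(* [normal_prob] is on [measurableTypeR R], whose measure display differs
   from that of [R] *)
have mWk : measurable_fun setT (W k : T -> measurableTypeR R).
  exact: measurable_W.
pose Wp : {mfun T >-> measurableTypeR R} :=
  HB.pack (W k) (isMeasurableFun.Build _ _ _ _ _ mWk).
rewrite -normal_prob_second_moment -/s12.
have mf : measurable_fun setT (fun x : R => (x ^+ 2)%:E).
  exact/measurable_EFinP/measurable_funX.
rewrite -(ge0_integral_distribution (P := P) Wp mf); last first.
  by move=> x; rewrite lee_fin sqr_ge0.
by apply: eq_measure_integral => A mA _; exact: law_W.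
Qed.

Let integrable_W_sqr k : P.-integrable setT (fun w => (W k w ^+ 2)%:E).
Proof.
apply/integrableP; split; first exact/measurable_EFinP/measurable_funX.
under eq_integral do rewrite gee0_abs ?lee_fin ?sqr_ge0//.
by rewrite integral_W_sqr ltry.
Qed.

Let has_expectation_W k : has_expectation P (W k) 0.
Proof.
(* Dominated by [W^2 + 1]. *)
have iW : P.-integrable setT (EFin \o W k).
  have i1 : P.-integrable setT (cst 1%:E).
    exact: finite_measure_integrable_cst.
  apply: le_integrable (integrableD _ (integrable_W_sqr k) i1) => //.
    exact/measurable_EFinP.
  move=> w _ /=; rewrite lee_fin [leRHS]ger0_norm ?addr_ge0 ?sqr_ge0//.
  rewrite -(real_normK (num_real (W k w))).
  have := sqr_ge0 (`|W k w| - 1); have := normr_ge0 (W k w); nra.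
split => //.
have mWk : measurable_fun setT (W k : T -> measurableTypeR R).
  exact: measurable_W.
pose Wp : {mfun T >-> measurableTypeR R} :=
  HB.pack (W k) (isMeasurableFun.Build _ _ _ _ _ mWk).
rewrite -[RHS](normal_prob_first_moment (R := R)) -/s12.
rewrite -(@integral_distribution _ _ _ _ _ P Wp EFin)//.
by apply: eq_measure_integral => A mA _; exact: law_W.
Qed.

Let has_expectation_WW k l :
  has_expectation P (fun w => W k w * W l w) (2^-1 *+ (k == l)).
Proof.
have [->|kl] := eqVneq k l.
  split; first exact: integrable_W_sqr.
  exact: integral_W_sqr.
rewrite mulr0n -[X in has_expectation _ _ X](mulr0 0).
apply: has_expectationM_indep => //.
by move=> A B mA mB; exact: indep_W.
Qed.

(** The real and imaginary parts are real affine combinations of [W], with coefficients [a] and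
    [a']. Each part contributes half of the sum of the [|c_i|^2], as the variance is 1/2 and both
    [a] and [a'] have squares summing to [|c_i|^2] at each [i]. *)
Lemma has_expectation_cabs_sqr_affine (z : R[i]) (c : I -> R[i]) :
  has_expectation P (fun w => cabs (z + \sum_i c i * X i w) ^+ 2)
    (cabs z ^+ 2 + \sum_i cabs (c i) ^+ 2).
Proof.
pose a (k : I * bool) :=
  if k.2 then complex.Re (c k.1) else - complex.Im (c k.1).
pose a' (k : I * bool) :=
  if k.2 then complex.Im (c k.1) else complex.Re (c k.1).
have pairE (F : I * bool -> R) :
    \sum_k F k = \sum_i (F (i, true) + F (i, false)).
  rewrite (eq_bigr (fun k => F (k.1, k.2))); last by case.
  rewrite -(pair_bigA _ (fun i b => F (i, b)))/=.
  by apply: eq_bigr => i _; rewrite big_bool.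
have -> : (fun w => cabs (z + \sum_i c i * X i w) ^+ 2) = (fun w =>
    (complex.Re z + \sum_k a k * W k w) ^+ 2 +
    (complex.Im z + \sum_k a' k * W k w) ^+ 2).
  apply/funext => w; rewrite cabs_sqr.
  congr (_ ^+ 2 + _ ^+ 2).
    rewrite ReD Re_sum pairE; congr +%R; apply: eq_bigr => i _.
    by rewrite /a /W /=; case: (c i) (X i w) => [? ?] [? ?] /=; rewrite mulNr.
  rewrite ImD Im_sum pairE; congr +%R; apply: eq_bigr => i _.
  by rewrite /a' /W /=; case: (c i) (X i w) => [? ?] [? ?] /=; rewrite addrC.
have -> : cabs z ^+ 2 + \sum_i cabs (c i) ^+ 2 =
    (complex.Re z ^+ 2 + 2^-1 * \sum_k a k ^+ 2) +
    (complex.Im z ^+ 2 + 2^-1 * \sum_k a' k ^+ 2).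
  rewrite cabs_sqr addrACA -mulrDr -big_split/= pairE mulr_sumr; congr +%R.
  by apply: eq_bigr => i _; rewrite cabs_sqr /a /a' /=; field.
by apply: has_expectationD; exact: has_expectation_sqr_affine.
Qed.

End complex_gaussian.
(** * Channels of the array *)

Section adjoint.
Context {R : realType}.
Implicit Types (z : R[i]).

Lemma adjmxM m n p (A : 'M[R[i]]_(m, n)) (B : 'M[R[i]]_(n, p)) :
  (A *m B)^t* = B^t* *m A^t*.
Proof. by rewrite trmx_mul map_mxM. Qed.

Lemma adjmxK m n (A : 'M[R[i]]_(m, n)) : (A^t*)^t* = A.
Proof. by apply/matrixP => i j; rewrite !mxE conjCK. Qed.

Lemma cabs_sqrE z : cabs z ^+ 2 = complex.Re (z^*%C * z).
Proof. by rewrite cabs_sqr; case: z => a b /=; ring. Qed.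

Lemma cabsM z1 z2 : cabs (z1 * z2) = cabs z1 * cabs z2.
Proof. by rewrite /cabs normrM !normc_def /= mulr0 subr0. Qed.

Lemma cabs_conj z : cabs z^*%C = cabs z.
Proof. by rewrite /cabs normcJ. Qed.

Lemma cabs_real (x : R) : cabs x%:C ^+ 2 = x ^+ 2.
Proof. by rewrite cabs_sqr /= expr0n addr0. Qed.

Lemma cabs_cis (x : R) : cabs (cis x) = 1.
Proof. by rewrite /cabs normc_def /= cos2Dsin2 sqrtr1. Qed.

Lemma cabs_sqr_sum (I : finType) (Q : pred I) (x : I -> R[i]) :
  cabs (\sum_(i | Q i) x i) ^+ 2 =
  \sum_(i | Q i) \sum_(j | Q j) complex.Re ((x i)^*%C * x j).
Proof.
rewrite cabs_sqrE rmorph_sum mulr_suml Re_sum; apply: eq_bigr => i _.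
by rewrite mulr_sumr Re_sum.
Qed.

(** Taking the adjoint exposes a conjugate of an expression in which the random channel enters
    linearly. *)
Lemma hdot_cascaded N Ms (u : 'cV[R[i]]_Ms) (h : 'cV[R[i]]_N) Theta
    (H : 'M[R[i]]_(N, Ms)) :
  hdot u (cascaded h Theta H) = ((h^t* *m Theta *m H *m u) 0 0)^*%C.
Proof. by rewrite /hdot /cascaded -adjmxM !mxE. Qed.

Lemma hdotxx n (u : 'cV[R[i]]_n) :
  hdot u u = (\sum_i cabs (u i 0) ^+ 2)%:C.
Proof.
rewrite /hdot mxE rmorph_sum; apply: eq_bigr => i _.
by rewrite !mxE cabs_sqr mulrC -sqr_normc -add_Re2_Im2.
Qed.

End adjoint.

(** * Mean received power over the subarrays of a Rician channel *)

Section subarrays.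
Context {R : realType} (Mx My S Ms : nat) (hM : (S * Ms = Mx * My)%N).

Let unidx (m : 'I_(Mx * My)) : 'I_S * 'I_Ms :=
  mxtens_unindex (cast_ord (esym hM) m).

Let subarray_idxK s l : unidx (subarray_idx hM s l) = (s, l).
Proof. by rewrite /unidx /subarray_idx cast_ordK mxtens_indexK. Qed.

Lemma sum_subarray_idx (V : nmodType) (F : 'I_(Mx * My) -> V) :
  \sum_m F m = \sum_s \sum_l F (subarray_idx hM s l).
Proof.
rewrite pair_bigA/=; apply: reindex; exists unidx => [[s l] _|m _].
  exact: subarray_idxK.
by rewrite /subarray_idx /unidx -surjective_pairing mxtens_unindexK cast_ordKV.
Qed.

Context d (T : measurableType d) (P : probability T R) (N : nat).
Variable Htilde : T -> 'M[R[i]]_(N, Mx * My).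
Hypothesis Htilde_iid : iid_CN01 P
  (fun (nm : 'I_N * 'I_(Mx * My)) w => Htilde w nm.1 nm.2).

(** The sum is affine in the entries of [Htilde]: its constant term is the line-of-sight part, and
    entry [(n, m)] has coefficient [beta * a_n * b_m]. This product form makes the sum of squared
    moduli factor. *)
Lemma has_expectation_rician (alpha beta : R) (Hbar : 'M[R[i]]_(N, Mx * My))
    (a : 'rV[R[i]]_N) (Q : {set 'I_S}) (e : 'I_S -> R)
    (v : 'I_S -> 'cV[R[i]]_Ms) :
  has_expectation P (fun w => cabs (\sum_(s in Q) (e s)%:C *
      (a *m colsub (subarray_idx hM s) (alpha%:C *: Hbar + beta%:C *: Htilde w)
         *m v s) 0 0) ^+ 2)
    (alpha ^+ 2 * cabs (\sum_(s in Q) (e s)%:C *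
      (a *m colsub (subarray_idx hM s) Hbar *m v s) 0 0) ^+ 2
     + beta ^+ 2 * (\sum_n cabs (a 0 n) ^+ 2) *
       \sum_(s in Q) e s ^+ 2 * \sum_l cabs (v s l 0) ^+ 2).
Proof.
(* Each antenna lies in exactly one subarray, so its weight is a single term, or 0 when that
   subarray is outside [Q]. *)
pose b m := if (unidx m).1 \in Q then
  (e (unidx m).1)%:C * v (unidx m).1 (unidx m).2 0 else 0.
pose c (nm : 'I_N * 'I_(Mx * My)) := beta%:C * a 0 nm.1 * b nm.2.
have := has_expectation_cabs_sqr_affine Htilde_iid
  (alpha%:C * \sum_(s in Q) (e s)%:C *
      (a *m colsub (subarray_idx hM s) Hbar *m v s) 0 0) c.
rewrite cabsM exprMn cabs_real.
have -> : \sum_nm cabs (c nm) ^+ 2 =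
  beta ^+ 2 * (\sum_n cabs (a 0 n) ^+ 2) *
       \sum_(s in Q) e s ^+ 2 * \sum_l cabs (v s l 0) ^+ 2.
  rewrite -(pair_bigA _ (fun n m => cabs (c (n, m)) ^+ 2))/=.
  rewrite -mulrA mulr_suml mulr_sumr; apply: eq_bigr => n _.
  rewrite sum_subarray_idx [in RHS]big_mkcond/= mulrA mulr_sumr.
  apply: eq_bigr => s _; case: ifPn => sQ; last first.
    rewrite mulr0 big1// => l _.
    by rewrite /c /b subarray_idxK/= (negbTE sQ) mulr0 (cabs_real 0) expr0n.
  rewrite !mulr_sumr; apply: eq_bigr => l _.
  by rewrite /c /b subarray_idxK/= sQ !cabsM !exprMn !cabs_real.
congr (has_expectation _ _ _); apply/funext => w; congr (cabs _ ^+ 2).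
rewrite -(pair_bigA _ (fun n m => c (n, m) * Htilde w n m))/=.
under [X in _ + X = _]eq_bigr do rewrite sum_subarray_idx.
rewrite [X in _ + X = _]exchange_big/= mulr_sumr.
rewrite [X in _ + X = _](_ : _ = \sum_(s in Q) \sum_n \sum_l
   (beta%:C * a 0 n * ((e s)%:C * v s l 0))
     * Htilde w n (subarray_idx hM s l)); last first.
  rewrite [RHS]big_mkcond; apply: eq_bigr => s _; case: ifPn => sQ.
    apply: eq_bigr => n _; apply: eq_bigr => l _.
    by rewrite /c /b subarray_idxK/= sQ.
  rewrite big1// => n _; rewrite big1// => l _.
  by rewrite /c /b subarray_idxK/= (negbTE sQ) mulr0 mul0r.
rewrite -big_split/=; apply: eq_bigr => s _.
rewrite -!mulmxA !mxE !mulr_sumr -big_split/=; apply: eq_bigr => n _.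
rewrite !mxE !mulr_sumr -big_split/=; apply: eq_bigr => l _.
by rewrite !mxE; ring.
Qed.

End subarrays.

Section antenna_gains.
Context {R : realType}.

Lemma cabs_ris_row (p q : nat) (theta : 'I_(p * q) -> R)
    (lambda dd az el varsigma : R) (n : 'I_(p * q)) : 0 <= varsigma ->
  cabs (((ris_user varsigma (steering p q lambda dd az el))^t*
     *m phase_mx theta) 0 n) ^+ 2 = varsigma.
Proof.
move=> v0; rewrite /phase_mx mul_mx_diag !mxE cabsM cabs_cis mulr1.
rewrite cabs_conj !cabsM !cabs_cis !exprMn cabs_real sqr_sqrtr//.
by rewrite !expr1n !mulr1.
Qed.

Lemma cabs_sqrtM (p : R) (z : R[i]) : 0 <= p ->
  cabs ((Num.sqrt p)%:C * z) ^+ 2 = p * cabs z ^+ 2.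
Proof. by move=> p0; rewrite cabsM exprMn cabs_real sqr_sqrtr. Qed.

End antenna_gains.

(** * Mean interference power from a far-field beam *)

Section far_interference.
Context {R : realType} (Mx My S Ms : nat) (hM : (S * Ms = Mx * My)%N).
Context d (T : measurableType d) (P : probability T R) (N Kn Kf : nat).
Variable Htilde : T -> 'M[R[i]]_(N, Mx * My).
Hypothesis Htilde_iid : iid_CN01 P
  (fun (nm : 'I_N * 'I_(Mx * My)) w => Htilde w nm.1 nm.2).
Variables (g : 'I_S -> 'I_Kn -> 'cV[R[i]]_Ms) (h : 'I_Kf -> 'cV[R[i]]_N).
Variables (Theta : 'M[R[i]]_N) (Hbar : 'M[R[i]]_(N, Mx * My)) (alpha beta : R).
Variables (Sf : 'I_Kf -> {set 'I_S}) (Pf : R) (etaf : 'I_S -> 'I_Kf -> R).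
Hypothesis Pf_ge0 : 0 <= Pf.

Let gt s j w := cascaded (h j) Theta
  (colsub (subarray_idx hM s) (alpha%:C *: Hbar + beta%:C *: Htilde w)).

(** Conjugation preserves the modulus and brings the signal to the Rician form with row [h^H Theta],
    weights [sqrt eta] and vectors [g s k]. *)
Lemma has_expectation_UI_far k j :
  has_expectation P (fun w => cabs (UI_far Sf Pf etaf g gt k j w) ^+ 2)
    (Pf * (alpha ^+ 2 * cabs (\sum_(s in Sf j) (Num.sqrt (etaf s j))%:C *
      ((h j)^t* *m Theta *m colsub (subarray_idx hM s) Hbar *m g s k) 0 0) ^+ 2
     + beta ^+ 2 * (\sum_n cabs (((h j)^t* *m Theta) 0 n) ^+ 2) *
       \sum_(s in Sf j) Num.sqrt (etaf s j) ^+ 2 *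
          \sum_l cabs (g s k l 0) ^+ 2)).
Proof.
have := has_expectationZ Pf (has_expectation_rician hM Htilde_iid alpha beta
  Hbar ((h j)^t* *m Theta) (Sf j) (fun s => Num.sqrt (etaf s j)) (g ^~ k)).
congr (has_expectation _ _ _); apply/funext => w.
rewrite /UI_far [RHS]cabs_sqrtM//; congr (Pf * _).
rewrite -[in RHS]cabs_conj rmorph_sum; congr (cabs _ ^+ 2).
apply: eq_bigr => s _.
rewrite [RHS]rmorphM hdot_cascaded -[RHS]/(_^*%C * (_^*%C)^*%C).
by rewrite conjcK conjc_real.
Qed.

End far_interference.

(** * The spectral efficiency of a near-field user *)

Theorem proposition1 (R : realType)
  (* array and subarrays *)
  (Mx My S Ms : nat) (Mx_odd : odd Mx) (My_odd : odd My)
  (hM : (S * Ms = Mx * My)%N)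
  (lambda : R) (lambda_gt0 : 0 < lambda)
  (* near-field users *)
  (Kn : nat) (ux uy uz : 'I_Kn -> R) (uz_gt0 : forall k, 0 < uz k)
  (* RIS and array-to-RIS channel *)
  (N1 N2 : nat)
  (theta : 'I_(N1 * N2) -> R) (theta_itv : forall n, 0 <= theta n < 2 * pi)
  (iota zeta : R) (iota_ge0 : 0 <= iota) (zeta_gt0 : 0 < zeta)
  (aoa_az aoa_el aod_az aod_el : R)
  (disp : measure_display) (T : measurableType disp) (P : probability T R)
  (Htilde : T -> 'M[R[i]]_(N1 * N2, Mx * My))
  (Htilde_iid : iid_CN01 P
     (fun (nm : 'I_(N1 * N2) * 'I_(Mx * My)) w => Htilde w nm.1 nm.2))
  (* far-field users *)
  (Kf : nat) (varsigma : 'I_Kf -> R) (varsigma_gt0 : forall j, 0 < varsigma j)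
  (usr_az usr_el : 'I_Kf -> R)
  (* visibility regions, powers, noise *)
  (Sn : 'I_Kn -> {set 'I_S}) (Sf : 'I_Kf -> {set 'I_S})
  (Pn Pf : R) (Pn_gt0 : 0 < Pn) (Pf_gt0 : 0 < Pf)
  (etan : 'I_S -> 'I_Kn -> R) (etan_ge0 : forall s k, 0 <= etan s k)
  (etaf : 'I_S -> 'I_Kf -> R) (etaf_ge0 : forall s j, 0 <= etaf s j)
  (sigma : 'I_Kn -> R) (sigma_gt0 : forall k, 0 < sigma k ^+ 2)
  (k : 'I_Kn) :
  let N := (N1 * N2)%N in
  let d := lambda / 2 in
  let dR := lambda / 2 in
  let alpha2 := Num.sqrt (iota * zeta / (iota + 1)) in
  let beta2 := Num.sqrt (zeta / (iota + 1)) in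
  let g (s : 'I_S) (i : 'I_Kn) : 'cV[R[i]]_Ms :=
    nf_channel lambda hM (ux i) (uy i) (uz i) s in
  let Theta := phase_mx theta in
  let Hbar := steering N1 N2 lambda dR aoa_az aoa_el
              *m (steering Mx My lambda d aod_az aod_el)^t* in
  let H2 w := alpha2%:C *: Hbar + beta2%:C *: Htilde w in
  let sub (s : 'I_S) (H : 'M[R[i]]_(N, Mx * My)) : 'M[R[i]]_(N, Ms) :=
    colsub (subarray_idx hM s) H in
  let h (j : 'I_Kf) : 'cV[R[i]]_N :=
    ris_user (varsigma j) (steering N1 N2 lambda dR (usr_az j) (usr_el j)) in
  let gt (s : 'I_S) (j : 'I_Kf) w := cascaded (h j) Theta (sub s (H2 w)) in
  let Psi (i : 'I_Kn) (s : 'I_S) := hdot (g s k) (g s i) in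
  let Mjj (j : 'I_Kf) : 'M[R[i]]_N :=
    Theta^t* *m h j *m (h j)^t* *m Theta in
  let Xi (j : 'I_Kf) (s s' : 'I_S) : R :=
    complex.Re (hdot (g s k)
      (((alpha2 ^+ 2)%:C *: ((sub s Hbar)^t* *m Mjj j *m sub s' Hbar)
        + ((s == s')%:R * varsigma j * beta2 ^+ 2 * N%:R)%:C *: 1%:M)
       *m g s' k)) in
  let Delta :=
    Pn * \sum_(i < Kn | i != k)
           cabs (\sum_(s in Sn i) (Num.sqrt (etan s i))%:C * Psi i s) ^+ 2
    + Pf * \sum_(j < Kf) \sum_(s in Sf j) \sum_(s' in Sf j)
             Num.sqrt (etaf s j * etaf s' j) * Xi j s s' in
  (* Psi k s = ||g s k||^2 has zero imaginary part *)
  let SINR :=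
    Pn * (\sum_(s in Sn k) Num.sqrt (etan s k) * complex.Re (Psi k s)) ^+ 2
    / (Delta + sigma k ^+ 2) in
  SINR_near P Sn Sf Pn Pf etan etaf sigma g g gt k = SINR%:E /\
  SE_near P Sn Sf Pn Pf etan etaf sigma g g gt k = (log2 (1 + SINR))%:E.
Proof.
move=> N d dR alpha2 beta2 g Theta Hbar H2 sub h gt Psi Mjj Xi Delta SINR.
pose a j := (h j)^t* *m Theta.
have aE j n : cabs (a j 0 n) ^+ 2 = varsigma j.
  exact: cabs_ris_row (ltW (varsigma_gt0 j)).
(* [Mjj j] is [(a j)^H (a j)], a column times a row, so its quadratic form splits into the product
   of the scalar [q j s'] with the conjugate of [q j s]. *)
pose q j s := (a j *m sub s Hbar *m g s k) 0 0.
have XiE j s s' : Xi j s s' = alpha2 ^+ 2 * complex.Re ((q j s)^*%C * q j s')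
    + (s == s')%:R * (varsigma j * beta2 ^+ 2 * N%:R
      * \sum_l cabs (g s k l 0) ^+ 2).
  have qq : (g s k)^t* *m ((sub s Hbar)^t* *m Mjj j *m sub s' Hbar *m g s' k)
      = (a j *m sub s Hbar *m g s k)^t* *m (a j *m sub s' Hbar *m g s' k).
    by rewrite /a /Mjj !adjmxM adjmxK !mulmxA.
  rewrite /Xi /hdot mulmxDl mulmxDr -!scalemxAl -!scalemxAr mul1mx qq.
  transitivity (complex.Re ((alpha2 ^+ 2)%:C * ((q j s)^*%C * q j s')
    + ((s == s')%:R * varsigma j * beta2 ^+ 2 * N%:R)%:C
      * hdot (g s k) (g s' k))).
    by congr complex.Re; rewrite /q /hdot !mxE big_ord1 !mxE.
  have [<-|_] := eqVneq s s'.
    rewrite !mul1r hdotxx; case: (q j s) => [x y] /=; ring.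
  by case: (q j s) (q j s') (hdot _ _) => [? ?] [? ?] [? ?] /=; ring.
have far j : ('E_P[(fun w => cabs (UI_far Sf Pf etaf g gt k j w) ^+ 2)%R] =
    (Pf * \sum_(s in Sf j) \sum_(s' in Sf j)
             Num.sqrt (etaf s j * etaf s' j) * Xi j s s')%:E)%E.
  have [_ E] := has_expectation_UI_far hM Htilde_iid g h Theta Hbar alpha2 beta2
    Sf etaf (ltW Pf_gt0) k j.
  rewrite unlock [LHS]E.
  (* The squared modulus becomes a double sum of cross terms, matching the [alpha2] part of [Xi];
     the [beta2] part survives only on the diagonal [s = s']. *)
  congr (_ * _)%:E; rewrite cabs_sqr_sum [X in X + _ = _]mulr_sumr.
  rewrite [X in _ + X = _]mulr_sumr -big_split/=.
  apply: eq_bigr => s sS; rewrite mulr_sumr.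
  rewrite [RHS](eq_bigr (fun s' =>
      alpha2 ^+ 2 * complex.Re (((Num.sqrt (etaf s j))%:C * q j s)^*%C
        * ((Num.sqrt (etaf s' j))%:C * q j s'))
      + (s == s')%:R * (etaf s j * (varsigma j * beta2 ^+ 2 * N%:R
          * \sum_l cabs (g s k l 0) ^+ 2)))); last first.
    move=> s' _; rewrite XiE sqrtrM// mulrDr; congr (_ + _).
      rewrite mulrCA; congr (_ * _).
      by case: (q j s) (q j s') => [? ?] [? ?] /=; ring.
    have [<-|ss'] := eqVneq s s'; last by rewrite !mul0r mulr0.
    by rewrite !mul1r -expr2 sqr_sqrtr.
  rewrite big_split/=; congr (_ + _).
  rewrite [in RHS](bigD1 s)//= eqxx mul1r.
  rewrite [X in _ = _ + X]big1 ?addr0; last first.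
    by move=> s' /andP[_ /negbTE]; rewrite eq_sym => ->; rewrite mul0r.
  rewrite (eq_bigr _ (fun n _ => aE j n)) sumr_const card_ord -/N.
  rewrite -[varsigma j *+ N]mulr_natr sqr_sqrtr//.
  ring.
(* The sign of the [Xi] sum is not visible from its formula; it is read off from [far], which
   identifies it with the expectation of a square. *)
have D0 : 0 <= Delta.
  apply: addr_ge0.
    by apply: mulr_ge0; [exact: ltW|apply: sumr_ge0 => i _; exact: sqr_ge0].
  rewrite mulr_sumr; apply: sumr_ge0 => j _; rewrite -lee_fin -far.
  by apply: expectation_ge0 => w; rewrite sqr_ge0.
have DSE : cabs (DS_near Sn Pn etan g g k) ^+ 2 =
  Pn * (\sum_(s in Sn k) Num.sqrt (etan s k) * complex.Re (Psi k s)) ^+ 2.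
  rewrite /DS_near [LHS](cabs_sqrtM _ (ltW Pn_gt0)); congr (Pn * _).
  (* By [hdotxx] each [Psi k s] is real, so the modulus squared of the sum is an ordinary square. *)
  rewrite -[RHS]cabs_real rmorph_sum; congr (cabs _ ^+ 2).
  apply: eq_bigr => s _.
  by rewrite rmorphM /Psi hdotxx.
have den0 : 0 < Delta + sigma k ^+ 2 by rewrite ltr_wpDl.
have SINRE : SINR_near P Sn Sf Pn Pf etan etaf sigma g g gt k = SINR%:E.
  rewrite /SINR_near [cabs (DS_near _ _ _ _ _ _) ^+ 2]DSE.
  rewrite (eq_bigr _ (fun j _ => far j)) !sumEFin -!EFinD.
  rewrite [X in (_ / X%:E)%E](_ : _ = Delta + sigma k ^+ 2); last first.
    congr (_ + _); rewrite /Delta -mulr_sumr; congr (_ + _).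
    rewrite mulr_sumr; apply: eq_bigr => i ik.
    by rewrite /UI_near [LHS](cabs_sqrtM _ (ltW Pn_gt0)).
  (* The positive noise power keeps the denominator nonzero, so the extended-real quotient is the
     real one. *)
  by rewrite inver gt_eqF.
(* This makes [1 + SINR] positive, where [lne] agrees with the real logarithm. *)
have SINR0 : 0 <= SINR.
  by rewrite /SINR divr_ge0 ?(ltW den0)// mulr_ge0 ?sqr_ge0// (ltW Pn_gt0).
split=> //; rewrite /SE_near SINRE -EFinD lne_EFin; last by rewrite ltr_pwDl.
by rewrite inver gt_eqF// ln_gt0// ltr1n.
Qed.
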